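(* For the RCSC problem with $T_t>T_c$ and $\hat{Q}=T_t/T_c$, the greedy algorithm described in the context, run with a $\beta$-approximation algorithm ($0<\beta<1$) for the rooted team orienteering problem as subroutine, covers at least $1-(1/e)^{\hat{Q}\beta/(2\hat{Q}-1)}$ times the optimal number of covered targets; with $\beta\approx 0.394$ this ratio exceeds $\tfrac16$.
   Context: Setting: targets $\mathcal{T}$ and charging stations $\mathcal{C}=\{c_1,\dots,c_K\}$ in a metric space (complete graph, symmetric edge lengths $d$ satisfying the triangle inequality); $M$ sensors of speed $V$; each sensor must visit a charging station at least once every $T_c$ time (charging time negligible); a target is covered if some sensor is at it in every time interval of length $T_t$. $L_c=VT_c$, $L_t=VT_t$. RCSC problem: each sensor may only charge at its original station; maximize the number of covered targets. Here $T_t>T_c$ and $\hat{Q}=T_t/T_c$ is an integer. Rooted team orienteering problem: given a graph, a root $s$, a length bound $L$ and a number $q$, find $q$ closed walks from $s$ each of length at most $L$ maximizing the number of distinct targets visited; a $\beta$-approximation returns walks visiting at least $\beta$ times the optimum. Algorithm: maintain uncovered targets $\hat{\mathcal{T}}$ (initially $\mathcal{T}$). For $j=1,\dots,M$: on the subgraph induced by $\hat{\mathcal{T}}\cup\mathcal{C}$, for each station $c_i$ call the $\beta$-approximate rooted team orienteering algorithm with root $c_i$, bound $L_c$ and $\hat{Q}$ walks; select the station whose $\hat{Q}$ walks cover the most targets; assign one sensor to traverse these $\hat{Q}$ closed walks one after another (each of length at most $L_c$, so it returns to $c_i$ within each charging period and repeats the whole route every $T_t$); remove the covered targets from $\hat{\mathcal{T}}$.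 *)

(* Defs.v *)
From HB Require Import structures.
From mathcomp Require Import all_boot all_order all_algebra.
From mathcomp Require Import boolp reals.
Set Implicit Arguments.
Unset Strict Implicit.
Unset Printing Implicit Defensive.
Import Order.TTheory GRing.Theory Num.Theory.
Local Open Scope ring_scope.

Section Defs.
Context {R : realType} {N : finType}.

Record is_metric (d : N -> N -> R) : Prop := IsMetric {
  metric_eq0 : forall x y, d x y = 0 <-> x = y;
  metric_sym : forall x y, d x y = d y x;
  metric_tri : forall x y z, d x z <= d x y + d y z }.

(** ** Rooted team orienteering *)

(* As in [path], a walk s, v_1, ..., v_n is given by its origin s and the
   sequence p = [:: v_1; ...; v_n]. *)
Definition walk_length (d : N -> N -> R) (s : N) (p : seq N) : R :=
  \sum_(l <- pairmap d s p) l.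

(* q closed walks from s of length at most L, in the subgraph induced by U *)
Definition closed_walks (d : N -> N -> R) (U : {set N}) (s : N) (L : R)
    (q : nat) (W : seq (seq N)) : bool :=
  (size W == q) &&
  all (fun p => [&& all (mem U) p, last s p == s & walk_length d s p <= L]) W.

Definition visited (X : {set N}) (s : N) (W : seq (seq N)) : {set N} :=
  [set x in X | has (fun p => x \in s :: p) W].

Definition orienteering_opt (d : N -> N -> R) (U X : {set N}) (s : N) (L : R)
    (q : nat) : nat :=
  \max_(S : {set N} |
     `[< exists2 W, closed_walks d U s L q W & visited X s W = S >]) #|S|.

(* An orienteering algorithm takes the vertex set U of an induced subgraph, the
   set X of targets, the root, the length bound and the number of walks. *)
Definition orienteering_algorithm : Type :=
  {set N} -> {set N} -> N -> R -> nat -> seq (seq N).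

Definition approximates_orienteering (d : N -> N -> R) (beta : R)
    (A : orienteering_algorithm) : Prop :=
  forall (U X : {set N}) (s : N) (L : R) (q : nat),
    s \in U -> X \subset U -> 0 <= L ->
    closed_walks d U s L q (A U X s L q) /\
    beta * (orienteering_opt d U X s L q)%:R
      <= #|visited X s (A U X s L q)|%:R.

(** ** Sensors, feasibility and coverage (RCSC) *)

(* [present t v] means that the sensor is at location v at time t; at a time
   spent inside an edge it is present nowhere. *)
Record sensor := Sensor { home : N; present : R -> N -> Prop }.

(* The third clause is the speed limit: moving along the edges at speed V (and
   possibly waiting), a sensor can be at u at time t1 and at v at time t2 >= t1
   iff d u v <= V * (t2 - t1).  At t1 = t2 it forces u = v. *)
Definition feasible_sensor (d : N -> N -> R) (C : {set N}) (V Tc : R)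
    (z : sensor) : Prop :=
  [/\ home z \in C,
      present z 0 (home z),
      forall t1 t2 u v, 0 <= t1 -> t1 <= t2 ->
        present z t1 u -> present z t2 v -> d u v <= V * (t2 - t1) &
      forall t, 0 <= t ->
        exists2 s, t <= s <= t + Tc & present z s (home z)].

(* The sensor covering x is the same one for all time windows. *)
Definition covered_targets (T : {set N}) (Tt : R) (M : nat)
    (P : 'I_M -> sensor) : {set N} :=
  [set x in T | `[< exists j : 'I_M, forall t, 0 <= t ->
                      exists2 s, t <= s <= t + Tt & present (P j) s x >]].

Definition rcsc_opt (d : N -> N -> R) (T C : {set N}) (V Tc Tt : R)
    (M : nat) : nat :=
  \max_(S : {set N} |
     `[< exists2 P : 'I_M -> sensor,
           forall j, feasible_sensor d C V Tc (P j) &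
           covered_targets T Tt P = S >]) #|S|.

(** ** The greedy algorithm *)

(* Walks proposed for station c when X is the set of uncovered targets *)
Definition greedy_walks (A : orienteering_algorithm) (C : {set N}) (L : R)
    (Q : nat) (X : {set N}) (c : N) : seq (seq N) :=
  A (X :|: C) X c L Q.

(* Uncovered targets after j steps, the station selected at step i being
   [sel i] *)
Fixpoint uncovered (A : orienteering_algorithm) (T C : {set N}) (L : R)
    (Q : nat) (sel : nat -> N) (j : nat) : {set N} :=
  if j is j'.+1 then
    let X := uncovered A T C L Q sel j' in
    X :\: visited X (sel j') (greedy_walks A C L Q X (sel j'))
  else T.

(* [sel] is a run of the algorithm; ties are broken arbitrarily. *)
Definition greedy_run (A : orienteering_algorithm) (T C : {set N}) (L : R)
    (Q M : nat) (sel : nat -> N) : Prop :=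
  forall j, (j < M)%N ->
    let X := uncovered A T C L Q sel j in
    let gain c := #|visited X c (greedy_walks A C L Q X c)| in
    sel j \in C /\ (forall c, c \in C -> (gain c <= gain (sel j))%N).

(* The sensor of station c that traverses the walks of W periodically, one per
   charging period: walk i is started at the times (k * size W + i) * Tc, is
   followed at speed V, and the sensor then waits at c.  Only the instants at
   which a vertex is reached or a walk is started are recorded: the waiting
   adds presence at c alone, which is already recorded every Tc. *)
Definition route (d : N -> N -> R) (V Tc : R) (c : N) (W : seq (seq N)) :
    sensor :=
  Sensor c (fun t v => exists k i m : nat,
    let p := nth [::] W i in
    [/\ (i < size W)%N, (m <= size p)%N, v = nth c (c :: p) m &
        t = (k * size W + i)%:R * Tc + walk_length d c (take m p) / V]).

Definition greedy_plan (A : orienteering_algorithm) (d : N -> N -> R)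
    (T C : {set N}) (V Tc : R) (Q M : nat) (sel : nat -> N) :
    'I_M -> sensor :=
  fun j => let X := uncovered A T C (V * Tc) Q sel j in
    route d V Tc (sel j) (greedy_walks A C (V * Tc) Q X (sel j)).

End Defs.
Arguments orienteering_algorithm R N : clear implicits.
Arguments sensor R N : clear implicits.

(* Main.v *)
(** Cut the trajectory of a sensor at greedily chosen charging times, each
    being the last one at most [Tc] after the previous one.  Then any two
    consecutive tours take at least [Tc] together.  Take [2 * Q - 1] consecutive
    tours and prolong the first one backwards and the last one forwards until
    both make closed walks of length [V * Tc]: they then contain a window of
    length [Q * Tc], hence visit every target of the sensor, and the best [Q] of
    them visit a fraction [Q / (2 * Q - 1)] of any set of these targets.  So each
    greedy step removes at least [Q * beta / ((2 * Q - 1) * M)] times the number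
    of still uncovered targets of an optimal plan. *)

Require Import Defs.
From mathcomp Require Import classical_sets.
From HB Require Import structures.
From mathcomp Require Import all_boot all_order all_algebra.
From mathcomp Require Import boolp reals sequences exp.
From mathcomp Require Import ring lra zify.
Set Implicit Arguments.
Unset Strict Implicit.
Unset Printing Implicit Defensive.
Import Order.TTheory GRing.Theory Num.Theory.
Local Open Scope ring_scope.

(** * Averaging: the best [q] among [q + r] values *)

(** Discarding an element of least value never lowers the average; doing so [r] times leaves [K]. *)
Lemma best_subset (I : finType) (f : I -> nat) (q r : nat) (J : {set I}) :
  #|J| = (q + r)%N ->
  exists2 K : {set I}, #|K| = q &
    (q * \sum_(i in J) f i <= #|J| * \sum_(i in K) f i)%N.
Proof.
elim: r J => [|r IH] J Jc; first by exists J; rewrite ?Jc addn0.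
have /card_gt0P[i0 i0J] : (0 < #|J|)%N by rewrite Jc addnS.
case: (arg_minnP f i0J) => i iJ fi_min.
have JiD : #|J| = #|J :\ i|.+1 by rewrite (cardsD1 i) (iJ : i \in J).
have Ji : #|J :\ i| = (q + r)%N by move: JiD; rewrite Jc addnS => -[].
have [K Kq HK] := IH _ Ji; exists K => //.
have sumJ : (\sum_(j in J) f j = f i + \sum_(j in J :\ i) f j)%N by rewrite (big_setD1 i).
have lei : (#|J :\ i| * f i <= \sum_(j in J :\ i) f j)%N.
  rewrite -sum_nat_const; apply: leq_sum => j; rewrite !inE => /andP[_]; exact: fi_min.
move: HK lei; rewrite sumJ JiD Ji.
move: (\sum_(j in J :\ i) f j)%N (\sum_(j in K) f j)%N (f i) => A B c HA Hc.
have [/eqP q0|q0] := boolP (q + r == 0)%N; first by have -> : q = 0%N by lia.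
rewrite -(leq_pmul2l (_ : 0 < q + r)%N) ?lt0n //.
nia.
Qed.

(** * Lengths of walks, and walks that follow a timetable *)

Section Walks.
Context {R : realType} {N : finType} (d : N -> N -> R) (dM : is_metric d).

Lemma metric_ge0 x y : 0 <= d x y.
Proof.
have := metric_tri dM x y x; rewrite (metric_sym dM y x).
have -> : d x x = 0 by apply/(metric_eq0 dM).
lra.
Qed.

Lemma metricxx x : d x x = 0.
Proof. exact/(metric_eq0 dM). Qed.

Lemma walk_length_nil s : walk_length d s [::] = 0.
Proof. by rewrite /walk_length big_nil. Qed.

Lemma walk_length_cons s x p :
  walk_length d s (x :: p) = d s x + walk_length d x p.
Proof. by rewrite /walk_length big_cons. Qed.

Lemma walk_length_cat s p q :
  walk_length d s (p ++ q) = walk_length d s p + walk_length d (last s p) q.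
Proof. by rewrite /walk_length pairmap_cat big_cat. Qed.

Lemma walk_length_ge_dist s p : d s (last s p) <= walk_length d s p.
Proof.
elim: p s => [|x p IH] s /=; first by rewrite metricxx walk_length_nil.
rewrite walk_length_cons; have := metric_tri dM s x (last x p).
by have := IH x; lra.
Qed.

Lemma walk_length_ge0 s p : 0 <= walk_length d s p.
Proof. exact: le_trans (metric_ge0 _ _) (walk_length_ge_dist _ _). Qed.

Lemma walk_length_take_le s p m :
  walk_length d s (take m p) <= walk_length d s p.
Proof.
by rewrite -{2}(cat_take_drop m p) walk_length_cat lerDl walk_length_ge0.
Qed.

Lemma dist_take s p m1 m2 : (m1 <= m2)%N ->
  d (last s (take m1 p)) (last s (take m2 p))
    <= walk_length d s (take m2 p) - walk_length d s (take m1 p).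
Proof.
move=> m12; rewrite -(cat_take_drop m1 (take m2 p)) take_takel //.
rewrite last_cat walk_length_cat.
have := walk_length_ge_dist (last s (take m1 p)) (drop m1 (take m2 p)); lra.
Qed.

Lemma nth_walk s (p : seq N) m : (m <= size p)%N ->
  nth s (s :: p) m = last s (take m p).
Proof. by case: m => [|m] mp; rewrite ?take0 // (take_nth s mp) last_rcons. Qed.

Lemma timed_walk_from (V b z : R) (tau : N -> R) (h y : N) (s : seq N) :
  0 <= V ->
  {in y :: s &, forall u v, tau u <= tau v -> d u v <= V * (tau v - tau u)} ->
  {in y :: s, forall u, d u h <= V * `|tau u - z| /\ tau u <= b} ->
  path (fun u v => tau u <= tau v) y s ->
  walk_length d y (rcons s h) <= V * (b - tau y + `|b - z|).
Proof.
move=> V0; elim: s y => [|x s IH] y Hd Hh /=.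
  move=> _; rewrite walk_length_cons walk_length_nil addr0.
  have [dy yb] := Hh y (mem_head _ _).
  apply: (le_trans dy); apply: ler_wpM2l => //.
  have := ler_normB (b - z) (b - tau y).
  have -> : b - z - (b - tau y) = tau y - z by ring.
  by rewrite (ger0_norm (_ : 0 <= b - tau y)) ?subr_ge0 //; lra.
move=> /andP[yx xs]; rewrite walk_length_cons.
have H1 : walk_length d x (rcons s h) <= V * (b - tau x + `|b - z|).
  apply: IH => // [u v us vs|u us].
    by apply: Hd; rewrite inE ?us ?vs orbT.
  by apply: Hh; rewrite inE us orbT.
have := Hd y x (mem_head _ _); rewrite !inE eqxx orbT => /(_ isT yx) H2.
by apply: (le_trans (lerD H2 H1)); rewrite -mulrDr ler_wpM2l //; lra.
Qed.

(** Here [z0] and [z1] stand for possible charging times at [h]. The inner legs telescope in time;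
    the legs from and to [h] are charged to the detours from [z0] to [a] and from [b] to [z1]. *)
Lemma timed_walk (V a b z0 z1 : R) (tau : N -> R) (h : N) (s : seq N) :
  0 <= V -> a <= b ->
  {in s &, forall u v, tau u <= tau v -> d u v <= V * (tau v - tau u)} ->
  {in s, forall u, [/\ d h u <= V * `|tau u - z0|, d h u <= V * `|tau u - z1|
                     & a <= tau u <= b]} ->
  sorted (fun u v => tau u <= tau v) s ->
  walk_length d h (rcons s h) <= V * (`|a - z0| + (b - a) + `|b - z1|).
Proof.
move=> V0 ab; case: s => [|y s] Hd Hh /=; rewrite walk_length_cons.
  move=> _; rewrite metricxx walk_length_nil addr0.
  by apply: mulr_ge0 => //; rewrite addr_ge0 // addr_ge0 // subr_ge0.
move=> ys; have H1 : walk_length d y (rcons s h) <= V * (b - tau y + `|b - z1|).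
  apply: timed_walk_from => // u us.
  by have [_ + /andP[_ ->]] := Hh u us; rewrite (metric_sym dM).
have [H2 _ /andP[ay yb]] := Hh y (mem_head _ _).
apply: (le_trans (lerD H2 H1)); rewrite -mulrDr; apply: ler_wpM2l => //.
have := ler_normD (a - z0) (tau y - a).
have -> : a - z0 + (tau y - a) = tau y - z0 by ring.
by rewrite (ger0_norm (_ : 0 <= tau y - a)) ?subr_ge0 //; lra.
Qed.

End Walks.

(** * Possible charging times of a feasible sensor *)

Section Charging.
Context {R : realType} {N : finType} (d : N -> N -> R) (dM : is_metric d).
Context (C : {set N}) (V Tc : R) (V_gt0 : 0 < V) (Tc_gt0 : 0 < Tc).
Context (z : sensor R N) (zF : feasible_sensor d C V Tc z).

(* The times at which the sensor could be at its station without breaking the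
   speed limit.  Unlike the actual charging times, they form a closed set, so
   that a last one before a deadline exists. *)
Definition could_charge (r : R) : Prop :=
  forall t v, 0 <= t -> present z t v -> d (home z) v <= V * `|t - r|.

Lemma could_charge_home r : 0 <= r -> present z r (home z) -> could_charge r.
Proof.
move=> r0 rz t v t0 tv; have [_ _ speed _] := zF.
have [rt|tr] := leP r t.
  by rewrite ger0_norm ?subr_ge0 //; apply: (speed r t).
rewrite (metric_sym dM) distrC gtr0_norm ?subr_gt0 //.
by apply: (speed t r) => //; exact: ltW.
Qed.

Lemma could_charge_closed r :
  (forall e, 0 < e -> exists2 s, could_charge s & `|s - r| <= e) ->
  could_charge r.
Proof.
move=> Hr t v t0 tv; apply/ler_addgt0Pr => e e0.
(* Shifting the time by [e / V] changes the distance bound by at most [e]. *)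
have [s sC sr] := Hr (e / V) (divr_gt0 e0 V_gt0).
apply: (le_trans (sC t v t0 tv)).
have -> : V * `|t - r| + e = V * (`|t - r| + e / V).
  by rewrite mulrDr mulrC mulrCA divff ?gt_eqF // mulr1 mulrC.
apply: ler_wpM2l; first exact: ltW.
have := ler_distD r t s; rewrite (distrC r s); lra.
Qed.

Definition last_charge (a : R) : R :=
  sup [set r | could_charge r /\ r <= a + Tc]%classic.

(** The set under the supremum contains [a], and its supremum is attained because possible charging
    times are closed under limits. *)
Lemma last_chargeP a : could_charge a ->
  [/\ could_charge (last_charge a), a <= last_charge a <= a + Tc &
      forall r, could_charge r -> r <= a + Tc -> r <= last_charge a].
Proof.
move=> aC; set E := [set r | could_charge r /\ r <= a + Tc]%classic.
have aE : E a by split=> //; rewrite lerDl ltW.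
have Eub : ubound E (a + Tc) by move=> r [].
have Esup : has_sup E by split; [exists a | exists (a + Tc)].
have le_sup r : E r -> r <= last_charge a by exact: ub_le_sup (proj2 Esup) _.
split.
- apply: could_charge_closed => e e0.
  have [r Er re] := sup_adherent e0 Esup; exists r; first by case: Er.
  have := le_sup r Er; rewrite ler_norml -/(last_charge a) in re *.
  by rewrite -/(last_charge a) in re *; lra.
- apply/andP; split; first exact: le_sup.
  by apply: ge_sup => //; exists a.
- by move=> r rC ra; apply: le_sup.
Qed.

(** Otherwise the second jump [q] still lies before [a + Tc], so [q = p] by maximality of [p], and
    no charge is possible in the interval from [p] (excluded) to [p + Tc]. The actual charge due
    within [Tc] after [p + e] must then fall between [p + Tc] and [p + Tc + e]. Letting [e] tend to
    0 makes [p + Tc] possible, a contradiction. *)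
Lemma last_charge2 a : 0 <= a -> could_charge a ->
  a + Tc <= last_charge (last_charge a).
Proof.
move=> a0 aC; have [pC /andP[ap pa] pmax] := last_chargeP aC.
have [qC /andP[pq qp] qmax] := last_chargeP pC.
set p := last_charge a in pC ap pa pmax pq qp qmax *.
set q := last_charge p in qC pq qp qmax *.
rewrite leNgt; apply/negP => qa.
have qEp : q = p by apply/eqP; rewrite eq_le pq pmax // ltW.
suff pTC : could_charge (p + Tc).
  by have := qmax _ pTC (lexx _); rewrite qEp; lra.
apply: could_charge_closed => e e0; have [_ _ _ charge] := zF.
have pe0 : 0 <= p + e by lra.
have [s /andP[s1 s2] sh] := charge _ pe0.
have sC : could_charge s by apply: could_charge_home => //; lra.
exists s => //; rewrite ler_norml.
have [spT|spT] := leP s (p + Tc); last by lra.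
by have := qmax s sC spT; rewrite qEp; lra.
Qed.

Lemma charging_times : exists t : nat -> R, forall k,
  [/\ could_charge (t k), Tc <= t k, t k <= t k.+1 <= t k + Tc &
      t k + Tc <= t k.+2].
Proof.
have [_ _ _ charge] := zF.
(* Starting no earlier than [Tc] leaves room to prolong the first tour backwards without reaching
   negative times. *)
have [t0 /andP[t0T _] t0h] := charge Tc (ltW Tc_gt0).
have t0C : could_charge t0 by apply: could_charge_home => //; have := Tc_gt0; lra.
have H k : could_charge (iter k last_charge t0) /\
    Tc <= iter k last_charge t0.
  elim: k => [|k [kC kT]] //=; have [pC /andP[ap _] _] := last_chargeP kC.
  by split=> //; lra.
exists (fun k => iter k last_charge t0) => k; have [kC kT] := H k.
have [_ ? _] := last_chargeP kC.
by split=> //=; apply: last_charge2 => //; have := Tc_gt0; lra.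
Qed.

(* With [Q = n.+1], the first of the [2 * Q - 1] tours is prolonged backwards by
   [(Tc - (t 1 - t 0)) / 2], the last one forwards likewise.  Half of the sum of
   the [2 * Q - 2] pairs of adjacent tours is at least [(Q - 1) * Tc], and the
   prolongations contribute the missing [Tc]. *)
Lemma breakpoints (n : nat) : (0 < n)%N -> exists t e : nat -> R,
  [/\ forall k, could_charge (t k), 0 <= e 0%N,
      e 0%N + n.+1%:R * Tc <= e n.*2.+1 &
      forall k, (k <= n.*2)%N -> e k <= e k.+1 /\
        `|e k - t k| + (e k.+1 - e k) + `|e k.+1 - t k.+1| <= Tc].
Proof.
move=> n0; have [t Ht] := charging_times.
have tS2 j m : t j + m%:R * Tc <= t (j + m.*2)%N.
  elim: m => [|m IH]; first by rewrite mul0r addn0 addr0.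
  have [_ _ _] := Ht (j + m.*2)%N; rewrite doubleS !addnS -natr1 mulrDl mul1r; lra.
exists t, (fun k => if k == 0%N then (t 0%N + t 1%N - Tc) / 2 else
  if k == n.*2.+1 then (t n.*2 + t n.*2.+1 + Tc) / 2 else t k).
split.
- by move=> k; case: (Ht k).
- by rewrite eqxx; have [_ ? _ _] := Ht 0%N; have [_ ? _ _] := Ht 1%N; have := Tc_gt0; lra.
(* The midpoints in [e] make the window length the average of the two chains starting at [t 0] and
   [t 1], plus [Tc]. *)
- rewrite !eqxx /=; have := tS2 0%N n; have := tS2 1%N n.
  rewrite add0n add1n -[n.+1%:R]natr1 (mulrDl n%:R) mul1r; lra.
- move=> k kn; have [_ _ /andP[tk1 tk2] _] := Ht k; rewrite eqSS /=.
  (* The prolongation counts twice, once in the window and once as a detour, hence the halving: the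
     total is exactly [Tc]. As [n > 0], the first tour is not also the last. *)
  have [k0|k0] := eqVneq k 0%N.
    rewrite k0 in tk1 tk2 *; rewrite ifF; last by apply/eqP; lia.
    rewrite subrr normr0 ler0_norm; last by lra.
    by split; lra.
  rewrite ifF; last by apply/eqP; lia.
  rewrite subrr normr0; case: eqP => [kE|_]; last by rewrite subrr normr0; split; lra.
  by rewrite -kE ger0_norm; [split|]; lra.
Qed.

(** * From a trajectory to [Q] closed walks *)

Lemma find_interval (e : nat -> R) (n : nat) (s : R) :
  e 0%N <= s <= e n.+1 -> exists2 k : 'I_n.+1, e k <= s & s <= e k.+1.
Proof.
elim: n => [|n IH] /andP[e0 en]; first by exists ord0.
have [sn|ns] := leP s (e n.+1).
  have [|k k1 k2] := IH; first by rewrite e0.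
  by exists (widen_ord (leqnSn _) k).
by exists ord_max => //=; exact: ltW.
Qed.

(** Each target of [S] is assigned one visiting instant in the window and the tour containing that
    instant. Every tour yields a closed walk through its targets in order of these instants; the [Q]
    tours with the most targets are kept. *)
Lemma sensor_walks (X S : {set N}) (Tt : R) (Q : nat) :
  S \subset X -> (1 < Q)%N -> Tt = Q%:R * Tc ->
  (forall x, x \in S -> forall t, 0 <= t ->
     exists2 s, t <= s <= t + Tt & present z s x) ->
  exists2 W, closed_walks d (X :|: C) (home z) (V * Tc) Q W &
    (Q * #|S| <= Q.-1.*2.+1 * #|visited X (home z) W|)%N.
Proof.
move=> SX; case: Q => [|[|n]] // _ TtE Hcov.
have [homeC _ speed _] := zF.
have [t [e [tC e0 en Hk]]] := @breakpoints n.+1 isT.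
(* The chosen instant and tour index; outside [S] the pair is a dummy. *)
have HS x : exists p : R * 'I_n.+1.*2.+1, x \in S ->
    [/\ 0 <= p.1, present z p.1 x & e p.2 <= p.1 <= e p.2.+1].
  have [xS|xS] := boolP (x \in S); last by exists (0, ord0).
  have [s /andP[s1 s2] sx] := Hcov x xS _ e0.
  have [|k k1 k2] := @find_interval e n.+1.*2 s.
    by rewrite s1 (le_trans s2) // TtE.
  by exists (s, k) => _; split; rewrite /= ?k1 //; apply: le_trans s1.
have [p Hp] := choice HS => {HS}.
pose tau x := (p x).1.
pose B k := [set x in S | (p x).2 == k].
pose walk k := rcons (sort (fun u v => tau u <= tau v) (enum (B k))) (home z).
(* Now [Q] is [n.+2], so the [2 * Q - 1] tours split as [n.+2 + n.+1]. *)
have [|K KQ Kbest] := @best_subset _ (fun k => #|B k|) n.+2 n.+1 setT.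
  by rewrite cardsT card_ord; lia.
exists [seq walk k | k <- enum K].
  rewrite /closed_walks size_map -cardE KQ eqxx /=.
  apply/allP => _ /mapP[k _ ->]; apply/and3P; split.
  - apply/allP => x; rewrite mem_rcons inE => /predU1P[->|].
      by rewrite /= in_setU homeC orbT.
    rewrite mem_sort mem_enum inE => /andP[/(subsetP SX) xX _].
    by rewrite /= in_setU xX.
  - by rewrite last_rcons.
  - have [ek ek2] := Hk k (ltn_ord k).
    apply: (@le_trans _ _ (V * (`|e k - t k| + (e k.+1 - e k) + `|e k.+1 - t k.+1|))).
      apply: (@timed_walk _ _ _ dM V _ _ _ _ tau) => //; first exact: ltW.
      + move=> u v; rewrite !mem_sort !mem_enum !inE => /andP[uS _] /andP[vS _] uv.
        have [u0 pu _] := Hp u uS; have [v0 pv _] := Hp v vS.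
        exact: speed.
      + move=> u; rewrite mem_sort mem_enum inE => /andP[uS /eqP uk].
        have [u0 pu] := Hp u uS; rewrite uk => uI.
        by split=> //; apply: tC.
      + by apply: sort_sorted => u v; exact: le_total.
    by apply: ler_wpM2l => //; exact: ltW.
(* Each target belongs to a single tour, so block sizes add up without overlap. *)
have sumB (J : {set 'I_n.+1.*2.+1}) :
    (\sum_(k in J) #|B k| = #|[set x in S | (p x).2 \in J]|)%N.
  rewrite -sum1_card (partition_big (fun x => (p x).2) (mem J)) /=.
    apply: eq_bigr => k kJ; rewrite -sum1_card; apply: eq_bigl => x.
    by rewrite !inE; case: eqP => [->|_]; rewrite ?kJ ?andbT ?andbF.
  by move=> x; rewrite inE => /andP[].
move: Kbest; rewrite !sumB cardsT card_ord /=.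
have -> : [set x in S | (p x).2 \in setT] = S by apply/setP=> x; rewrite !inE andbT.
move=> /leq_trans; apply; apply: leq_mul => //; apply: subset_leq_card.
apply/subsetP => x; rewrite !inE => /andP[xS xK].
rewrite (subsetP SX _ xS) /=; apply/hasP; exists (walk (p x).2).
  by apply: map_f; rewrite mem_enum.
by rewrite !(inE, mem_rcons) mem_sort mem_enum inE xS eqxx !orbT.
Qed.

End Charging.

(** * Feasibility and coverage of the periodic routes *)

Section Route.
Context {R : realType} {N : finType} (d : N -> N -> R) (dM : is_metric d).
Context (C U : {set N}) (V Tc : R) (V_gt0 : 0 < V) (Tc_gt0 : 0 < Tc).
Context (c : N) (Q : nat) (W : seq (seq N)).
Hypotheses (cC : c \in C) (Q_gt0 : (0 < Q)%N).
Hypothesis (HW : closed_walks d U c (V * Tc) Q W).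

Lemma size_closed_walks : size W = Q.
Proof. by case/andP: HW => /eqP. Qed.

Lemma closed_walk_nth i : (i < size W)%N ->
  last c (nth [::] W i) = c /\ walk_length d c (nth [::] W i) <= V * Tc.
Proof.
move=> iW; case/andP: HW => _ /allP/(_ _ (mem_nth [::] iW)).
by case/and3P=> _ /eqP.
Qed.

Let time (k i m : nat) : R := (k * size W + i)%:R * Tc +
  walk_length d c (take m (nth [::] W i)) / V.

Lemma mul_speed_time k i m : V * time k i m =
  (k * size W + i)%:R * (V * Tc) + walk_length d c (take m (nth [::] W i)).
Proof. by rewrite /time; field; exact: lt0r_neq0. Qed.

(** Instants are ordered lexicographically by charging period, then position. In different periods,
    the path through [c] works: the first walk closes within its own period and the second starts at
    [c] in a later one. In the same period, both points lie on one walk. *)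
Lemma route_dist k1 i1 m1 k2 i2 m2 : (i1 < size W)%N -> (i2 < size W)%N ->
  (k1 * size W + i1 < k2 * size W + i2)%N ||
    ((k1 * size W + i1 == k2 * size W + i2)%N && (m1 <= m2)%N) ->
  d (last c (take m1 (nth [::] W i1))) (last c (take m2 (nth [::] W i2)))
    <= V * (time k2 i2 m2 - time k1 i1 m1).
Proof.
move=> i1W i2W; rewrite mulrBr !mul_speed_time.
case/orP=> [g12|/andP[/eqP g12 m12]].
  set p1 := nth [::] W i1; set p2 := nth [::] W i2.
  have [p1c p1L] := closed_walk_nth i1W.
  have := metric_tri dM (last c (take m1 p1)) c (last c (take m2 p2)).
  have := walk_length_ge_dist dM c (take m2 p2).
  have : d (last c (take m1 p1)) c <= V * Tc - walk_length d c (take m1 p1).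
    have := walk_length_ge_dist dM (last c (take m1 p1)) (drop m1 p1).
    have : walk_length d c (take m1 p1) +
        walk_length d (last c (take m1 p1)) (drop m1 p1) <= V * Tc.
      by rewrite -walk_length_cat cat_take_drop.
    rewrite -last_cat cat_take_drop p1c; lra.
  have VT : 0 < V * Tc by rewrite mulr_gt0.
  have : (k1 * size W + i1)%:R * (V * Tc) + V * Tc <= (k2 * size W + i2)%:R * (V * Tc).
    by rewrite -[X in _ + X]mul1r -mulrDl natr1 ler_pM2r // ler_nat.
  lra.
have i12 : i1 = i2.
  by have := congr1 (modn^~ (size W)) g12; rewrite !modnMDl !modn_small.
rewrite g12 i12; have := dist_take dM c (nth [::] W i2) m12; lra.
Qed.

Lemma route_feasible : feasible_sensor d C V Tc (route d V Tc c W).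
Proof.
split=> //=.
- exists 0%N, 0%N, 0%N; split=> //=; first by rewrite size_closed_walks.
  by rewrite take0 walk_length_nil !mul0r addr0.
- move=> t1 t2 u v t10 t12 [k1 [i1 [m1 [i1W m1p -> t1E]]]] [k2 [i2 [m2 [i2W m2p -> t2E]]]].
  rewrite !nth_walk //.
  (* If the lexicographic order disagrees with [t1 <= t2], the reversed bound [V * (t1 - t2)] is
     nonpositive and hence still small enough. *)
  have [H|H] := boolP ((k1 * size W + i1 < k2 * size W + i2)%N ||
    ((k1 * size W + i1 == k2 * size W + i2)%N && (m1 <= m2)%N)).
    by rewrite t1E t2E; exact: route_dist.
  rewrite (metric_sym dM); apply: (@le_trans _ _ (V * (t1 - t2))).
    rewrite t1E t2E; apply: route_dist => //; move: H; lia.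
  by rewrite ler_pM2l //; lra.
- move=> t t0; have tT : 0 <= t / Tc by rewrite divr_ge0 // ltW.
  have /andP[] := Num.Theory.truncn_itv tT; set g := Num.Def.trunc _ => g1 g2.
  (* The start of the next charging period, when the sensor is at [c]. *)
  exists (g.+1%:R * Tc).
    move: g1 g2; rewrite ler_pdivlMr // ltr_pdivrMr // -natr1 mulrDl mul1r.
    by move=> g1 g2; rewrite (ltW g2); lra.
  exists (g.+1 %/ size W)%N, (g.+1 %% size W)%N, 0%N; split=> //.
    by rewrite ltn_mod size_closed_walks.
  by rewrite -divn_eq take0 walk_length_nil mul0r addr0.
Qed.

(** A round of [Q] walks lasts exactly [Tt], so the visit at time [a] of round 0 recurs with period
    [Tt]; as [a <= Tt], the initial windows are served too. *)
Lemma route_visits (X : {set N}) (Tt : R) (x : N) : Tt = Q%:R * Tc ->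
  x \in visited X c W -> forall t, 0 <= t ->
  exists2 s, t <= s <= t + Tt & present (route d V Tc c W) s x.
Proof.
move=> TtE; rewrite inE => /andP[_ /hasP[p /(nthP [::])[i iW pE] xp]] t t0.
set m := index x (c :: p).
have mp : (m <= size p)%N by rewrite -ltnS -[(size p).+1]/(size (c :: p)) index_mem.
have Tt0 : 0 < Tt by rewrite TtE mulr_gt0 // ltr0n.
pose a := time 0 i m.
have pL : 0 <= walk_length d c (take m p) <= V * Tc.
  rewrite walk_length_ge0 //= (le_trans (walk_length_take_le dM _ _ _)) // -pE.
  by have [] := closed_walk_nth iW.
have timeE k : time k i m = a + k%:R * Tt.
  rewrite /a /time TtE mul0n add0n natrD natrM size_closed_walks; ring.
have a0 : 0 <= a <= Tt.
  have : 0 <= walk_length d c (take m p) / V <= Tc.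
    case/andP: pL => p0 pT; rewrite divr_ge0 ?(ltW V_gt0) //=.
    by rewrite ler_pdivrMr // mulrC.
  have : (i.+1%:R : R) <= Q%:R by rewrite ler_nat -size_closed_walks.
  rewrite /a /time pE TtE mul0n add0n -natr1; have : 0 <= i%:R :> R by [].
  move: (i%:R : R) (Q%:R : R) => i' Q'; nra.
have presE k : present (route d V Tc c W) (a + k%:R * Tt) x.
  exists k, i, m; rewrite pE; split=> //; first by rewrite nth_index.
  by rewrite -timeE /time pE.
have [ta|at_] := leP t a.
  by exists (a + 0%:R * Tt); [rewrite mul0r addr0; lra | exact: presE].
have tT : 0 <= (t - a) / Tt by rewrite divr_ge0 // ltW // subr_gt0.
have /andP[] := Num.Theory.truncn_itv tT; set g := Num.Def.trunc _.
rewrite ler_pdivlMr // ltr_pdivrMr // -natr1 mulrDl mul1r => g1 g2.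
by exists (a + g.+1%:R * Tt); [rewrite -natr1 mulrDl mul1r; lra | exact: presE].
Qed.

End Route.

(** * Progress of the greedy algorithm *)

Lemma card_bigcup_le (T I : finType) (F : I -> {set T}) :
  (#|\bigcup_i F i| <= \sum_i #|F i|)%N.
Proof.
elim/big_rec2: _ => [|i n A _ IH]; first by rewrite cards0.
by rewrite cardsU (leq_trans (leq_subr _ _)) // leq_add2l.
Qed.

Section Greedy.
Context {R : realType} {N : finType} (d : N -> N -> R) (dM : is_metric d).
Context (T C : {set N}) (M : nat) (V Tc Tt : R) (Q : nat) (beta : R).
Context (A : orienteering_algorithm R N) (sel : nat -> N).
Hypotheses (V_gt0 : 0 < V) (Tc_gt0 : 0 < Tc) (Q_gt1 : (1 < Q)%N).
Hypotheses (TtE : Tt = Q%:R * Tc) (beta_gt0 : 0 < beta).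
Hypothesis A_approx : approximates_orienteering d beta A.
Hypothesis sel_run : greedy_run A T C (V * Tc) Q M sel.

Local Notation X := (uncovered A T C (V * Tc) Q sel).
Local Notation gset j :=
  (visited (X j) (sel j) (greedy_walks A C (V * Tc) Q (X j) (sel j))).

Lemma greedy_walks_approx (Y : {set N}) c : c \in C ->
  closed_walks d (Y :|: C) c (V * Tc) Q (greedy_walks A C (V * Tc) Q Y c) /\
  beta * (orienteering_opt d (Y :|: C) Y c (V * Tc) Q)%:R
    <= #|visited Y c (greedy_walks A C (V * Tc) Q Y c)|%:R.
Proof.
move=> cC; apply: A_approx; rewrite ?inE ?cC ?orbT //; first exact: subsetUl.
by rewrite mulr_ge0 // ltW.
Qed.

Lemma uncovered_subset j : X j \subset T.
Proof.
elim: j => //= j IH; apply: subset_trans IH; exact: subsetDl.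
Qed.

Lemma covered_uncovered :
  T :\: X M \subset covered_targets T Tt
    (@greedy_plan R N A d T C V Tc Q M sel).
Proof.
apply/subsetP => x; rewrite inE => /andP[xX xT]; rewrite inE xT /=.
have removed m : (m <= M)%N -> x \notin X m ->
    exists2 j, (j < M)%N & x \in gset j.
  elim: m => [|j IH] jM /=; first by rewrite xT.
  rewrite in_setD negb_and negbK => /orP[xj|xj]; first by exists j.
  exact: IH (ltnW jM) xj.
have [j jM xj] := removed M (leqnn M) xX.
apply/asboolP; exists (Ordinal jM) => t t0.
have [selC _] := sel_run jM; have [HW _] := greedy_walks_approx (X j) selC.
exact: (route_visits dM V_gt0 Tc_gt0 (ltnW Q_gt1) HW TtE xj).
Qed.

(** For each sensor of [P], the walks extracted from its trajectory compete in the orienteering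
    problem at its home; the selected station gains at least [beta] times their value. Summing over
    the [M] sensors gives the bound, with denominators cleared. *)
Lemma greedy_gain j (P : 'I_M -> sensor R N) : (j < M)%N ->
  (forall i, feasible_sensor d C V Tc (P i)) ->
  beta * Q%:R * #|covered_targets T Tt P :&: X j|%:R
    <= M%:R * (2 * Q%:R - 1) * #|gset j|%:R.
Proof.
move=> jM PF; have [_ gain_max] := sel_run jM.
pose S i := [set x in X j | `[< forall t, 0 <= t ->
  exists2 s, t <= s <= t + Tt & present (P i) s x >]].
have QE : 2 * Q%:R - 1 = Q.-1.*2.+1%:R :> R.
  by rewrite -[RHS]natr1 -addnn natrD -subn1 natrB ?(ltnW Q_gt1) //; ring.
have gainS i : beta * Q%:R * #|S i|%:R <= (2 * Q%:R - 1) * #|gset j|%:R.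
  have [|x|W HW WS] := sensor_walks dM V_gt0 Tc_gt0 (PF i)
    (_ : S i \subset X j) Q_gt1 TtE.
  - by apply/subsetP => x; rewrite inE => /andP[].
  - by rewrite inE => /andP[_ /asboolP].
  have [homeC _ _ _] := PF i.
  have [_ approx] := greedy_walks_approx (X j) homeC.
  have opt : (#|visited (X j) (home (P i)) W| <=
      orienteering_opt d (X j :|: C) (X j) (home (P i)) (V * Tc) Q)%N.
    apply: (@leq_bigmax_cond _ _ (fun S' : {set N} => #|S'|)
      (visited (X j) (home (P i)) W)).
    by apply/asboolP; exists W.
  have {}gain_max := gain_max _ homeC.
  rewrite -mulrA -natrM QE.
  apply: (@le_trans _ _ (beta * (Q.-1.*2.+1 * #|visited (X j) (home (P i)) W|)%:R)).
    by rewrite ler_pM2l // ler_nat.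
  rewrite natrM mulrCA ler_pM2l ?ltr0n //.
  apply: (@le_trans _ _ (beta * (orienteering_opt d (X j :|: C) (X j) (home (P i)) (V * Tc) Q)%:R)).
    by rewrite ler_pM2l // ler_nat.
  by apply: (le_trans approx); rewrite ler_nat.
have -> : M%:R * (2 * Q%:R - 1) * #|gset j|%:R =
    \sum_(i < M) (2 * Q%:R - 1) * #|gset j|%:R :> R.
  by rewrite sumr_const card_ord -[RHS]mulr_natl mulrA.
apply: (@le_trans _ _ (\sum_(i < M) beta * Q%:R * #|S i|%:R)); last first.
  by apply: ler_sum.
rewrite -mulr_sumr ler_pM2l ?mulr_gt0 ?ltr0n ?(ltnW Q_gt1) //.
rewrite -natr_sum ler_nat; apply: leq_trans (card_bigcup_le _).
apply: subset_leq_card; apply/subsetP => x.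
rewrite !inE => /andP[/andP[_ /asboolP[i xi]] xX].
by apply/bigcupP; exists i => //; rewrite inE xX; exact/asboolP.
Qed.

(** The left side is the deficit of the greedy algorithm against [P] after [j] steps; each step
    shrinks it by a fixed factor. *)
Lemma greedy_uncovered (P : 'I_M -> sensor R N) : beta < 1 ->
  (forall i, feasible_sensor d C V Tc (P i)) ->
  forall j, (j <= M)%N ->
  #|covered_targets T Tt P|%:R - #|T|%:R + #|X j|%:R
    <= (1 - Q%:R * beta / (2 * Q%:R - 1) / M%:R) ^+ j
         * #|covered_targets T Tt P|%:R :> R.
Proof.
move=> beta_lt1 PF; set O := covered_targets T Tt P.
have OT : O \subset T by apply/subsetP => x; rewrite inE => /andP[].
have Q1 : 1 < Q%:R :> R by rewrite ltr1n.
have D0 : 0 < 2 * Q%:R - 1 :> R by lra.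
set y := Q%:R * beta / (2 * Q%:R - 1).
have y1 : y <= 1 by rewrite /y ler_pdivrMr //; nra.
elim=> [|j IH] jM; first by rewrite expr0 mul1r /= subrK.
have M0 : 0 < M%:R :> R by rewrite ltr0n; exact: leq_trans jM.
have := greedy_gain jM PF; rewrite -/O.
have -> : #|X j.+1|%:R = #|X j|%:R - #|gset j|%:R :> R.
  have gX : gset j \subset X j by apply/subsetP => x; rewrite inE => /andP[].
  rewrite /= cardsD natrB ?subset_leq_card ?subsetIl //.
  by have /setIidPr -> := gX.
(* The deficit is at most the number of targets of [P] still uncovered, by inclusion-exclusion
   inside [T]. *)
have OX : #|O|%:R - #|T|%:R + #|X j|%:R <= #|O :&: X j|%:R :> R.
  rewrite addrAC lerBlDr -!natrD ler_nat -cardsUI addnC leq_add2l.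
  by rewrite subset_leq_card // subUset OT uncovered_subset.
set o := #|O|%:R in OX IH *; set u := #|X j|%:R in OX IH *.
set w := #|O :&: X j|%:R in OX *; set g := #|gset j|%:R.
move=> gain; have {}gain : y / M%:R * w <= g.
  have -> : y / M%:R * w = beta * Q%:R * w / (M%:R * (2 * Q%:R - 1)).
    by rewrite /y; field; rewrite !gt_eqF.
  by rewrite ler_pdivrMr ?mulr_gt0 // [leRHS]mulrC.
have yM0 : 0 <= y / M%:R.
  by rewrite divr_ge0 ?(ltW M0) // /y divr_ge0 ?(ltW D0) // mulr_ge0 // ltW.
have yM1 : y / M%:R <= 1.
  by rewrite ler_pdivrMr // mul1r (le_trans y1) // ler1n; exact: leq_trans jM.
(* The gain is at least [y / M] times the old deficit, and the factor [1 - y / M] is nonnegative, so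
   the induction hypothesis can be multiplied by it. *)
rewrite exprS -mulrA; apply: le_trans (ler_wpM2l _ (IH (ltnW jM))).
  rewrite addrA mulrBl mul1r lerD2l lerN2; apply: le_trans gain.
  exact: ler_wpM2l.
by rewrite subr_ge0.
Qed.
End Greedy.

(** * Exponential estimates and the approximation ratio *)

Lemma expr_1sub_le_expR (R : realType) (y : R) (M : nat) :
  (0 < M)%N -> y <= M%:R -> (1 - y / M%:R) ^+ M <= expR (- y).
Proof.
move=> M0 yM; have M0' : 0 < M%:R :> R by rewrite ltr0n.
have -> : - y = - (y / M%:R) * M%:R by rewrite mulNr divfK ?gt_eqF.
rewrite expRM_natr; apply: lerXn2r; rewrite ?nnegrE ?expR_ge0 //.
  by rewrite subr_ge0 ler_pdivrMr // mul1r.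
exact: expR_ge1Dx.
Qed.

(** The bound [1 + x] falls just short of [6 / 5]; squaring [1 + x / 2] suffices, as
    [1.09825 ^ 2 > 1.206]. *)
Lemma expR_gt_6_5 (R : realType) (x : R) : 1965 / 10000 <= x -> 6 / 5 < expR x.
Proof.
move=> hx; have := expR_ge1Dx (x / 2).
have -> : expR x = expR (x / 2) ^+ 2 by rewrite -expRM_natr divfK // pnatr_eq0.
move: (expR (x / 2)) => e; nra.
Qed.

Theorem theorem4 (R : realType) (N : finType) (d : N -> N -> R)
    (T C : {set N}) (M : nat) (V Tc Tt : R) (Q : nat) (beta : R)
    (A : orienteering_algorithm R N) (sel : nat -> N)
    (dM : is_metric d) (V_gt0 : 0 < V) (Tc_gt0 : 0 < Tc) (Tc_lt_Tt : Tc < Tt)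
    (QE : Tt / Tc = Q%:R)
    (beta_gt0 : 0 < beta) (beta_lt1 : beta < 1)
    (A_approx : approximates_orienteering d beta A)
    (sel_run : greedy_run A T C (V * Tc) Q M sel) :
  let ratio := 1 - ((expR 1)^-1 `^ (Q%:R * beta / (2 * Q%:R - 1)))%R in
  let P := @greedy_plan R N A d T C V Tc Q M sel in
  [/\ forall j, feasible_sensor d C V Tc (P j),
      ratio * (rcsc_opt d T C V Tc Tt M)%:R <= #|covered_targets T Tt P|%:R &
      `|beta - 394 / 1000| <= 1 / 1000 -> 1 / 6 < ratio].
Proof.
move=> ratio P.
have TtE : Tt = Q%:R * Tc by rewrite -QE divfK ?gt_eqF.
have Q_gt1 : (1 < Q)%N by rewrite -(ltr1n R) -QE ltr_pdivlMr // mul1r.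
have Q1 : 1 < Q%:R :> R by rewrite ltr1n.
have D0 : 0 < 2 * Q%:R - 1 :> R by lra.
rewrite {}/ratio; set y := Q%:R * beta / (2 * Q%:R - 1).
have -> : (expR 1)^-1 `^ y = expR (- y) by rewrite -expRN -expRM mulN1r.
split.
- move=> j; have [selC _] := sel_run j (ltn_ord j).
  have [HW _] := greedy_walks_approx Q V_gt0 Tc_gt0 A_approx
    (uncovered A T C (V * Tc) Q sel j) selC.
  exact: (route_feasible dM V_gt0 Tc_gt0 selC (ltnW Q_gt1) HW).
(* The bound is stable under maxima, so a single feasible plan is considered. *)
- rewrite /rcsc_opt; apply: (big_ind (fun n : nat => _ * n%:R <= _)).
  + by rewrite mulr0.
  + by move=> m n Hm Hn; rewrite /maxn; case: ifP.
  move=> S /asboolP[P' P'F <-]; set O := covered_targets T Tt P'.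
  (* Without sensors nothing is covered; the case is separate because the decay factor divides by
     [M]. *)
  have [M0|M0] := posnP M.
    have -> : #|O| = 0%N; last by rewrite mulr0.
    apply/eqP; rewrite cards_eq0 -subset0; apply/subsetP => x.
    by rewrite inE => /andP[_ /asboolP[[j jM]]]; exfalso; move: jM; rewrite M0.
  have := greedy_uncovered dM V_gt0 Tc_gt0 Q_gt1 TtE beta_gt0 A_approx sel_run
    beta_lt1 P'F (leqnn M).
  have y1 : y <= M%:R.
    apply: (@le_trans _ _ 1); last by rewrite ler1n.
    by rewrite /y ler_pdivrMr //; nra.
  have := expr_1sub_le_expR M0 y1; rewrite -/y -/O.
  have := subset_leq_card (covered_uncovered dM V_gt0 Tc_gt0 Q_gt1 TtE A_approx sel_run).
  rewrite -/P -(ler_nat R) cardsD (setIidPr (uncovered_subset _ _ _ _ _ _ _ _)).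
  rewrite natrB ?subset_leq_card ?uncovered_subset //.
  have : 0 <= #|O|%:R :> R by [].
  move: (expR _) (_ ^+ M) (#|O|%:R : R) => e p o; nra.
- rewrite ler_norml => /andP[b1 b2].
  (* [Q / (2 * Q - 1) > 1 / 2] and [beta >= 393 / 1000] *)
  have y2 : 1965 / 10000 <= y.
    by rewrite /y ler_pdivlMr //; nra.
  have e65 := expR_gt_6_5 y2; rewrite expRN.
  have : (expR y)^-1 < (6 / 5)^-1 by rewrite ltf_pV2 ?posrE ?expR_gt0 //; lra.
  lra.
Qed.
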